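(* Let $(G,\mathfrak{B}_0)$ be a Rota-Baxter Lie group and let $\mathfrak{B}_1$ be an action of $(G,\mathfrak{B}_0)$ on a manifold $M$, written $\mathfrak{B}_1:G\times M\to M$, $(g,m)\mapsto\mathfrak{B}_1(g,m)$. Let $\mathbb{G}=M\times G\times M\rightrightarrows M$ be the Lie groupoid with $$s(m,g,n):=n,\qquad t(m,g,n):=m,\qquad (m',h,n')\cdot(m,g,n):=(m',hg,n)\ \text{ when } n'=m,$$ whose bundle of isotropy groups is $G\times M\to M$, included in $\mathbb{G}$ by $(g,m)\mapsto(m,g,m)$. Then the map $\mathfrak{B}:G\times M\to M\times G\times M$ given by $\mathfrak{B}(g,m)=(m,\mathfrak{B}_0(g),\mathfrak{B}_1(g,m))$ is a Rota-Baxter operator on the Lie groupoid $\mathbb{G}$.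
   Context: For a group $G$, $\mathrm{Ad}_g h:=ghg^{-1}$. A Rota-Baxter Lie group is a Lie group $G$ with a smooth map $\mathfrak{B}_0:G\to G$ such that $\mathfrak{B}_0(g_1)\mathfrak{B}_0(g_2)=\mathfrak{B}_0(g_1\,\mathrm{Ad}_{\mathfrak{B}_0(g_1)}g_2)$ for all $g_1,g_2$. Then $g_1*g_2:=g_1\,\mathrm{Ad}_{\mathfrak{B}_0(g_1)}g_2$ defines another Lie group structure $(G,* )$ on $G$ (the descendent Lie group). An action of $(G,\mathfrak{B}_0)$ on $M$ is a (smooth) right action $\mathfrak{B}_1$ of the Lie group $(G,* )$ on $M$, so $\mathfrak{B}_1(e,m)=m$ and $\mathfrak{B}_1(h,\mathfrak{B}_1(g,m))=\mathfrak{B}_1(g*h,m)$. For a transitive Lie groupoid $\mathbb{G}\rightrightarrows M$ (i.e. $s(t^{-1}(m))=M$ for $m\in M$), with product $g_1\cdot g_2$ defined when $s(g_1)=t(g_2)$, let $\mathcal{H}$ be the bundle of isotropy groups $\mathcal{H}_m=s^{-1}(m)\cap t^{-1}(m)$. A Rota-Baxter operator on $\mathbb{G}$ is a map $\mathfrak{B}:\mathcal{H}\to\mathbb{G}$ with $t\circ\mathfrak{B}=t$ and $\mathfrak{B}(g)\mathfrak{B}(h)=\mathfrak{B}(g\,\mathrm{Ad}_{\mathfrak{B}(g)}h)$ for all $g,h\in\mathcal{H}$ such that $s(\mathfrak{B}(g))=t(h)$, where $\mathrm{Ad}_{\mathfrak{B}(g)}h=\mathfrak{B}(g)h\mathfrak{B}(g)^{-1}$.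 *)

(* Defs.v *)
From HB Require Import structures.
From mathcomp Require Import all_boot all_order all_algebra.
From mathcomp Require Import all_classical all_reals all_analysis.

Set Implicit Arguments.
Unset Strict Implicit.
Unset Printing Implicit Defensive.

Import Order.TTheory GRing.Theory Num.Theory.
Import numFieldNormedType.Exports.

Local Open Scope classical_set_scope.
Local Open Scope ring_scope.

(* The functions are total, but only their restriction to the open set [U]
   matters.  In infinite dimension [Ck] would be weaker than Frechet C^k; all
   model spaces here are finite products of spaces ['rV[R]_n]. *)

Section Calculus.
Context {R : realType} {E F : normedModType R}.

Fixpoint Ck (k : nat) (U : set E) (f : E -> F) : Prop :=
  if k is k'.+1 then
    {in U, forall x, differentiable f x} /\
    forall v : E, Ck k' U (fun x => 'd f x v)
  else {in U, continuous f}.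

Definition Cinfty (U : set E) (f : E -> F) : Prop := forall k, Ck k U f.

End Calculus.

(* [chart_inv] is the inverse of the chart on its image; its values elsewhere
   are irrelevant.  Atlases need not be maximal. *)

Record chart (M E : Type) := Chart {
  chart_dom : set M;
  chart_map : M -> E;
  chart_inv : E -> M }.

Definition chart_prod (M N E F : Type) (c : chart M E) (d : chart N F) :
    chart (M * N) (E * F) :=
  Chart (chart_dom c `*` chart_dom d)
        (fun x => (chart_map c x.1, chart_map d x.2))
        (fun u => (chart_inv c u.1, chart_inv d u.2)).

Definition atlas_prod (M N E F : Type)
    (A : set (chart M E)) (B : set (chart N F)) : set (chart (M * N) (E * F)) :=
  [set chart_prod c d | c in A & d in B].

Section Manifold.
Context {R : realType} {E : normedModType R} {M : topologicalType}.

Record is_chart (c : chart M E) : Prop := {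
  chart_dom_open : open (chart_dom c);
  chart_img_open : open (chart_map c @` chart_dom c);
  chart_mapK : {in chart_dom c, cancel (chart_map c) (chart_inv c)};
  chart_map_continuous : {in chart_dom c, continuous (chart_map c)};
  chart_inv_continuous :
    {in chart_map c @` chart_dom c, continuous (chart_inv c)} }.

Record smooth_manifold (A : set (chart M E)) : Prop := {
  manifold_hausdorff : hausdorff_space M;
  manifold_countable : @second_countable M;
  manifold_charts : forall c, A c -> is_chart c;
  manifold_cover : forall x, exists2 c, A c & chart_dom c x;
  manifold_compat : forall c d, A c -> A d ->
    Cinfty (chart_map c @` (chart_dom c `&` chart_dom d))
           (chart_map d \o chart_inv c) }.

End Manifold.

Section SmoothMaps.
Context {R : realType} {E F : normedModType R} {M N : topologicalType}.
Variables (A : set (chart M E)) (B : set (chart N F)).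

Definition in_charts (c : chart M E) (d : chart N F) (f : M -> N) : E -> F :=
  chart_map d \o f \o chart_inv c.

(* Only used for open U. *)
Definition smooth_on (U : set M) (f : M -> N) : Prop :=
  {in U, continuous f} /\
  forall c d, A c -> B d ->
    Cinfty (chart_map c @` (chart_dom c `&` U `&` f @^-1` chart_dom d))
           (in_charts c d f).

Definition smooth (f : M -> N) : Prop := smooth_on setT f.

(* Smoothness of a map defined on a subset: it extends locally to a smooth map.
   If S is an embedded submanifold this is smoothness on the manifold S. *)
Definition smooth_subset (S : set M) (f : S -> N) : Prop :=
  forall x : S, exists U (g : M -> N),
    [/\ open U, U (val x), smooth_on U g
      & forall y : S, U (val y) -> g (val y) = f y].

Definition submersion (f : M -> N) : Prop :=
  smooth f /\
  forall c d x, A c -> B d -> chart_dom c x -> chart_dom d (f x) ->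
    range ('d (in_charts c d f) (chart_map c x) : E -> F) = setT.

End SmoothMaps.

(* The compatibility of the group operations with the topology is part of
   [lie_group] below. *)
#[short(type="topGroupType")]
HB.structure Definition TopGroup := {G of Group G & Topological G}.

Record lie_group (R : realType) (E : normedModType R) (G : topGroupType)
    (A : set (chart G E)) : Prop := {
  lie_manifold : smooth_manifold A;
  lie_mul : smooth (atlas_prod A A) A (fun x : G * G => (x.1 * x.2)%g);
  lie_inv : smooth A A (fun x : G => (x^-1)%g) }.

Definition Ad (G : groupType) (g h : G) : G := (g * h * g^-1)%g.

Definition descendent_mul (G : groupType) (B0 : G -> G) (g1 g2 : G) : G :=
  (g1 * Ad (B0 g1) g2)%g.

Record rota_baxter_lie_group (R : realType) (E : normedModType R)
    (G : topGroupType) (A : set (chart G E)) (B0 : G -> G) : Prop := {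
  rblg_lie : lie_group A;
  rblg_smooth : smooth A A B0;
  rblg_mul : forall g1 g2 : G,
    (B0 g1 * B0 g2)%g = B0 (g1 * Ad (B0 g1) g2)%g }.

(* A right action on M of the descendent Lie group, whose unit is that of G *)
Record rota_baxter_action (R : realType) (E F : normedModType R)
    (G : topGroupType) (M : topologicalType)
    (AG : set (chart G E)) (AM : set (chart M F))
    (B0 : G -> G) (B1 : G * M -> M) : Prop := {
  rba_smooth : smooth (atlas_prod AG AM) AM B1;
  rba_one : forall m : M, B1 (1%g, m) = m;
  rba_mul : forall (g h : G) (m : M),
    B1 (h, B1 (g, m)) = B1 (descendent_mul B0 g h, m) }.

(* The product is a total function, meaningful when src g = tgt h. *)
Record groupoid (M X : Type) := Groupoid {
  src : X -> M;
  tgt : X -> M;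
  gunit : M -> X;
  ginv : X -> X;
  gmul : X -> X -> X;
  src_mul : forall g h, src g = tgt h -> src (gmul g h) = src h;
  tgt_mul : forall g h, src g = tgt h -> tgt (gmul g h) = tgt g;
  gmulA : forall g h k, src g = tgt h -> src h = tgt k ->
    gmul g (gmul h k) = gmul (gmul g h) k;
  src_unit : forall m, src (gunit m) = m;
  tgt_unit : forall m, tgt (gunit m) = m;
  gmul1g : forall g, gmul (gunit (tgt g)) g = g;
  gmulg1 : forall g, gmul g (gunit (src g)) = g;
  src_inv : forall g, src (ginv g) = tgt g;
  tgt_inv : forall g, tgt (ginv g) = src g;
  gmulgV : forall g, gmul g (ginv g) = gunit (tgt g);
  gmulVg : forall g, gmul (ginv g) g = gunit (src g) }.

Section GroupoidTheory.
Context {M X : Type} (H : groupoid M X).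

Definition composable : set (X * X) := [set p | src H p.1 = tgt H p.2].

(* The total space of the bundle of isotropy groups *)
Definition isotropy : set X := [set g | src H g = tgt H g].

Lemma isotropyP (g : isotropy) : src H (val g) = tgt H (val g).
Proof. exact: set_mem (valP g). Qed.

Definition gAd (x h : X) : X := gmul H (gmul H x h) (ginv H x).

Lemma src_gAd (x h : X) :
  src H x = tgt H h -> src H h = tgt H h -> src H (gAd x h) = tgt H x.
Proof.
move=> xh hh; rewrite src_mul ?src_inv//.
by rewrite src_mul// tgt_inv hh.
Qed.

Lemma tgt_gAd (x h : X) :
  src H x = tgt H h -> src H h = tgt H h -> tgt H (gAd x h) = tgt H x.
Proof.
move=> xh hh; rewrite tgt_mul ?tgt_mul//.
by rewrite src_mul// tgt_inv hh.
Qed.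

Lemma isotropy_mulAd_subproof (g h : isotropy) (x : X) :
  tgt H x = tgt H (val g) -> src H x = tgt H (val h) ->
  gmul H (val g) (gAd x (val h)) \in isotropy.
Proof.
move=> xg xh; have hh := isotropyP h; have gg := isotropyP g.
have e : src H (val g) = tgt H (gAd x (val h)) by rewrite tgt_gAd// xg.
by apply/mem_set; rewrite /isotropy/= src_mul// tgt_mul// src_gAd.
Qed.

Definition isotropy_mulAd (g h : isotropy) (x : X)
    (xg : tgt H x = tgt H (val g)) (xh : src H x = tgt H (val h)) : isotropy :=
  SigSub (isotropy_mulAd_subproof xg xh).

Definition transitive_groupoid : Prop :=
  forall m : M, src H @` (tgt H @^-1` [set m]) = setT.

End GroupoidTheory.

(* The set of composable pairs is an embedded submanifold because src is a
   submersion, and so is [isotropy H] when H is transitive, hence the use of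
   [smooth_subset]. *)
Section LieGroupoid.
Context {R : realType} {E F : normedModType R} {M X : topologicalType}.
Variables (AM : set (chart M E)) (AX : set (chart X F)) (H : groupoid M X).

Record lie_groupoid : Prop := {
  lie_groupoid_base : smooth_manifold AM;
  lie_groupoid_arrows : smooth_manifold AX;
  lie_groupoid_src : submersion AX AM (src H);
  lie_groupoid_tgt : submersion AX AM (tgt H);
  lie_groupoid_unit : smooth AM AX (gunit H);
  lie_groupoid_inv : smooth AX AX (ginv H);
  lie_groupoid_mul : smooth_subset (atlas_prod AX AX) AX
    (fun p : composable H => gmul H (val p).1 (val p).2) }.

Record rota_baxter_operator (B : isotropy H -> X) : Prop := {
  rbo_smooth : smooth_subset AX AX B;
  rbo_tgt : forall g, tgt H (B g) = tgt H (val g);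
  rbo_mul : forall (g h : isotropy H) (e : src H (B g) = tgt H (val h)),
    gmul H (B g) (B h) = B (isotropy_mulAd (rbo_tgt g) e) }.

End LieGroupoid.

Section TrivialGroupoid.
Variables (M : Type) (G : groupType).

Definition trivial_groupoid : groupoid M (M * G * M).
Proof.
refine (@Groupoid M (M * G * M) (fun x => x.2) (fun x => x.1.1)
  (fun m => (m, 1%g, m))
  (fun x => (x.2, (x.1.2^-1)%g, x.1.1))
  (fun x y => (x.1.1, (x.1.2 * y.1.2)%g, y.2))
  _ _ _ _ _ _ _ _ _ _ _) => //=.
- by move=> g h k _ _; rewrite mulgA.
- by move=> [[m g] n]; rewrite mul1g.
- by move=> [[m g] n]; rewrite mulg1.
- by move=> g; rewrite mulgV.
- by move=> g; rewrite mulVg.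
Defined.

Definition isotropy_incl (x : G * M) : isotropy trivial_groupoid :=
  @SigSub _ _ (isotropy trivial_groupoid) (x.2, x.1, x.2)
    (mem_set (erefl : isotropy trivial_groupoid (x.2, x.1, x.2))).

Definition isotropy_coord (h : isotropy trivial_groupoid) : G * M :=
  ((val h).1.2, (val h).1.1).

Lemma isotropy_inclK : cancel isotropy_incl isotropy_coord.
Proof. by case. Qed.

Lemma isotropy_coordK : cancel isotropy_coord isotropy_incl.
Proof.
case=> [[[m g] n] hx]; apply: val_inj => /=.
by have nm : n = m := set_mem hx; rewrite /isotropy_coord/= nm.
Qed.

End TrivialGroupoid.

Definition bundle_map (M : Type) (G : groupType) (B0 : G -> G)
    (B1 : G * M -> M) (x : G * M) : M * G * M :=
  (x.2, B0 x.1, B1 x).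

(* Main.v *)
From HB Require Import structures.
Require Import Defs.
From mathcomp Require Import all_boot all_order all_algebra.
From mathcomp Require Import all_classical all_reals all_analysis.
Import numFieldNormedType.Exports.

(** The algebraic content is one line: the arrows B (g, m) and B (h, n) are
    composable exactly when n = B1 (g, m), and then both sides of the
    Rota-Baxter identity start with m, their middle entries agree by the
    identity for B0, and their last entries agree because B1 is a right action
    of the descendent product.  The rest is differential geometry: M * G
    * M is a Lie groupoid, and B is smooth on the isotropy bundle.

    That part rests on one observation.  Every map involved is a tuple whose
    components are a smooth map that is already given (the multiplication and
    the inversion of G, B0, B1, an identity or a constant) preceded by a
    rearrangement of factors, such as ((m, g), n) |-> (g, m).  In product charts
    a rearrangement is a continuous linear map between model spaces
    ([chartwise_linear]).  Smoothness thus follows from two stability properties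
    of smooth maps: under precomposition with such a rearrangement
    ([smooth_comp_chartwise_linear]) and under pairing ([smooth_pair]).  The
    general composition theorem for C^k maps is avoided: since [Ck] is defined
    through directional derivatives, it would require coordinates on the
    intermediate space, whereas for L linear the derivative of f \o L along v is
    just the derivative of f along L v, composed with L.

    Source and target are submersions because in charts they are a surjective
    linear map followed by a transition map, and the derivative of a transition
    map is invertible, its inverse being the derivative of the reverse
    transition ([transition_diff_surj]).  Smoothness on the composable pairs and
    on the isotropy bundle needs no local extension argument: the maps in
    question are restrictions of smooth maps on the whole ambient product
    ([smooth_subset_global]). *)

Set Implicit Arguments.
Unset Strict Implicit.
Unset Printing Implicit Defensive.

Import Order.TTheory GRing.Theory Num.Theory.

Local Open Scope classical_set_scope.
Local Open Scope ring_scope.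

(** * Calculus of C^k maps *)

Section NearDiff.
Context {R : realType} {E F : normedModType R}.

(** The differential is a local notion.  As ['d] is chosen from the first-order
    expansion, this goes through the uniqueness of that expansion. *)
Lemma near_eq_diff (f g : E -> F) (x : E) :
  (\forall y \near x, f y = g y) -> differentiable f x ->
  differentiable g x /\ 'd g x = 'd f x :> (E -> F).
Proof.
move=> fg df; have fgx := nbhs_singleton fg.
have dfc := diff_continuous df.
have e : g \o shift x = cst (g x) + 'd f x +o_ 0 id.
  apply/eqaddoP => eps eps0.
  have /eqaddoP/(_ eps eps0) := diff_locally df.
  have := fg; rewrite [\forall y \near x, _](near_shift 0) => fg0.
  apply: filter_app; apply: filter_app fg0; near=> h => /=.
  by rewrite subr0 !fctE => ->; rewrite fgx.
have dg : 'd g x = 'd f x :> (E -> F) by exact: diff_unique dfc e.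
by split=> //; apply/diff_locallyP; rewrite dg.
Unshelve. all: by end_near. Qed.

End NearDiff.

Section CkTheory.
Context {R : realType}.
Implicit Types E F G : normedModType R.

(** Openness of U makes equality on U an equality near each point of U, so it
    passes to the derivatives and the induction can proceed. *)
Lemma Ck_ext E F k (U : set E) (f g : E -> F) : open U ->
  {in U, f =1 g} -> Ck k U f -> Ck k U g.
Proof.
move=> oU; elim: k f g => [|k IH] f g fg /=.
  move=> cf x xU; rewrite /continuous_at -fg//; apply: cvg_trans (cf x xU).
  apply: near_eq_cvg; near=> y; apply: fg; rewrite inE.
  by near: y; apply: open_nbhs_nbhs; split=> //; rewrite -inE.
have dfg x : x \in U -> differentiable f x ->
    differentiable g x /\ 'd g x = 'd f x :> (E -> F).
  move=> xU; apply: near_eq_diff; near=> y; apply: fg; rewrite inE.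
  by near: y; apply: open_nbhs_nbhs; split=> //; rewrite -inE.
move=> [df ckf]; split=> [x xU|v]; first by case: (dfg x xU (df x xU)).
apply: IH (ckf v) => x xU; by case: (dfg x xU (df x xU)) => _ ->.
Unshelve. all: by end_near. Qed.

Lemma Ck_subset E F k (U V : set E) (f : E -> F) :
  V `<=` U -> Ck k U f -> Ck k V f.
Proof.
move=> VU; elim: k f => [|k IH] f /=.
  by move=> cf x; rewrite inE => /VU xU; apply: cf; rewrite inE.
move=> [df ckf]; split=> [x|v]; last exact: IH.
by rewrite inE => /VU xU; apply: df; rewrite inE.
Qed.

Lemma Ck_cst E F k (U : set E) (a : F) : Ck k U (fun=> a).
Proof.
elim: k a => [|k IH] a /=; first by move=> x _; exact: cvg_cst.
split=> [x _|v]; first exact: differentiable_cst.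
suff -> : (fun x => 'd (fun=> a) x v) = fun _ : E => (0 : F) by exact: IH.
by apply/funext => x; rewrite diff_cst.
Qed.

Lemma Ck_pair E F1 F2 k (U : set E) (f : E -> F1) (g : E -> F2) : open U ->
  Ck k U f -> Ck k U g -> Ck k U (fun x => (f x, g x)).
Proof.
move=> oU; elim: k f g => [|k IH] f g /=.
  by move=> cf cg x xU; apply: cvg_pair; [exact: cf|exact: cg].
move=> [df ckf] [dg ckg]; split=> [x xU|v].
  by apply: differentiable_pair; [exact: df|exact: dg].
apply: Ck_ext (IH _ _ (ckf v) (ckg v)) => // x xU.
by rewrite diff_pair; [|exact: df|exact: dg].
Qed.

Lemma linear_continuous_diff E F (L : E -> F) x : linear L -> continuous L ->
  differentiable L x /\ 'd L x = L :> (E -> F).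
Proof.
move=> linL cL.
pose LM := GRing.isLinear.Build _ _ _ _ _ linL.
pose LL : {linear E -> F} := HB.pack L LM.
split; first exact: (@linear_differentiable _ _ _ LL).
exact: (@diff_lin _ _ _ LL).
Qed.

(** On U, the derivative of f \o L along v is (fun y => 'd f y (L v)) \o L: it
    has the same form, for the single direction L v, which is what makes the
    induction on k work without any assumption on the dimension of F. *)
Lemma Ck_comp_linear E F G k (U : set E) (V : set F) (L : E -> F) (f : F -> G) :
  open U -> linear L -> continuous L -> (forall x, U x -> V (L x)) ->
  Ck k V f -> Ck k U (f \o L).
Proof.
move=> oU linL cL UV; have LV x : x \in U -> L x \in V.
  by rewrite !inE; exact: UV.
elim: k f => [|k IH] f /=.
  by move=> cf x xU; apply: continuous_comp; [exact: cL|exact/cf/LV].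
move=> [df ckf]; split=> [x xU|v].
  have dfL := df _ (LV _ xU).
  apply: differentiable_comp => //.
  by case: (linear_continuous_diff x linL cL).
apply: Ck_ext (IH _ (ckf (L v))) => // x xU.
have [dL dLE] := linear_continuous_diff x linL cL.
have dfL := df _ (LV _ xU).
have -> : 'd (f \o L) x v = 'd f (L x) ('d L x v) by rewrite diff_comp.
by rewrite dLE.
Qed.

End CkTheory.

(** * Products of manifolds *)

Section ProductTopology.
Context {M N : topologicalType}.

Lemma open_setX (A : set M) (B : set N) : open A -> open B -> open (A `*` B).
Proof.
move=> oA oB; rewrite openE => -[x y] [/= Ax By].
by exists (A, B) => //=; split; apply: open_nbhs_nbhs.
Qed.

Lemma hausdorff_pair :
  hausdorff_space M -> hausdorff_space N -> hausdorff_space (M * N)%type.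
Proof.
move=> hM hN [x1 x2] [y1 y2] cl; congr pair.
- apply: hM => A B Ax By; have [||z [Az Bz]] := cl (fst @^-1` A) (fst @^-1` B).
  + exact: cvg_fst.
  + exact: cvg_fst.
  by exists z.1.
- apply: hN => A B Ax By; have [||z [Az Bz]] := cl (snd @^-1` A) (snd @^-1` B).
  + exact: cvg_snd.
  + exact: cvg_snd.
  by exists z.2.
Qed.

Lemma second_countable_pair :
  @second_countable M -> @second_countable N ->
  @second_countable (M * N)%type.
Proof.
move=> [B cB [oB bB]] [C cC [oC bC]].
exists ((fun p => p.1 `*` p.2) @` (B `*` C)).
  by apply: sub_countable (card_image_le _ _) _; exact: countableX.
split=> [_ [[U V] [/= BU CV] <-]|[x y] W].
  by apply: open_setX; [exact: oB|exact: oC].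
move=> [[W1 W2] [/= W1x W2y] W12].
have [U [BU Ux] UW] := bB x _ W1x.
have [V [CV Vy] VW] := bC y _ W2y.
exists (U `*` V); first by split=> //; exists (U, V).
by move=> z [Uz Vz]; apply: W12; split; [exact: UW|exact: VW].
Qed.

End ProductTopology.

Section Charts.
Context {R : realType}.

(** A chart is an open map because its inverse is continuous on an open image. *)
Lemma chart_image_open (E : normedModType R) (M : topologicalType)
    (c : chart M E) (W : set M) :
  is_chart c -> open W -> open (chart_map c @` (chart_dom c `&` W)).
Proof.
move=> hc oW; rewrite openE => _ [x [cx Wx] <-].
have ucx : (chart_map c @` chart_dom c) (chart_map c x) by exists x.
have xK : chart_inv c (chart_map c x) = x.
  by apply: (chart_mapK hc); rewrite inE.
have : nbhs (chart_map c x) (chart_map c @` chart_dom c).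
  by apply: open_nbhs_nbhs; split=> //; exact: chart_img_open hc.
have : nbhs (chart_map c x) (chart_inv c @^-1` W).
  apply: (chart_inv_continuous hc); first by rewrite inE.
  by rewrite xK; apply: open_nbhs_nbhs.
apply: filterS2 => u + [y cy yu]; rewrite -{}yu => Wu.
exists y => //; split=> //.
by have := Wu; rewrite /preimage/= (chart_mapK hc)// inE.
Qed.

Lemma is_chart_prod (E F : normedModType R) (M N : topologicalType)
    (c : chart M E) (d : chart N F) :
  is_chart c -> is_chart d -> is_chart (chart_prod c d).
Proof.
move=> hc hd.
have imE : chart_map (chart_prod c d) @` chart_dom (chart_prod c d) =
    (chart_map c @` chart_dom c) `*` (chart_map d @` chart_dom d).
  apply/seteqP; split=> [_ [[x y] [/= cx dy] <-]|].
    by split; [exists x|exists y].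
  move=> [u v] [/= [x cx <-] [y dy <-]].
  by exists (x, y).
split.
- by apply: open_setX; exact: chart_dom_open.
- by rewrite imE; apply: open_setX; exact: chart_img_open.
- move=> [x y]; rewrite inE => -[/= cx dy].
  by rewrite /= (chart_mapK hc) ?(chart_mapK hd)// inE.
- move=> [x y]; rewrite inE => -[/= cx dy]; apply: cvg_pair => /=.
    apply: (cvg_comp fst); first exact: cvg_fst.
    by apply: (chart_map_continuous hc); rewrite inE.
  apply: (cvg_comp snd); first exact: cvg_snd.
  by apply: (chart_map_continuous hd); rewrite inE.
- rewrite imE => -[u v]; rewrite inE => -[/= cu dv]; apply: cvg_pair => /=.
    apply: (cvg_comp fst); first exact: cvg_fst.
    by apply: (chart_inv_continuous hc); rewrite inE.
  apply: (cvg_comp snd); first exact: cvg_snd.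
  by apply: (chart_inv_continuous hd); rewrite inE.
Qed.

Lemma continuous_fst (M N : topologicalType) : continuous (@fst M N).
Proof. by move=> x; exact: cvg_fst. Qed.

Lemma continuous_snd (M N : topologicalType) : continuous (@snd M N).
Proof. by move=> x; exact: cvg_snd. Qed.

(** The transition maps of product charts are pairs of transition maps, each
    precomposed with a linear projection. *)
Lemma smooth_manifold_prod (E F : normedModType R) (M N : topologicalType)
    (A : set (chart M E)) (B : set (chart N F)) :
  smooth_manifold A -> smooth_manifold B -> smooth_manifold (atlas_prod A B).
Proof.
move=> hA hB.
have charts c : atlas_prod A B c -> is_chart c.
  move=> [c1 Ac1 [c2 Bc2 <-]].
  by apply: is_chart_prod; [exact: manifold_charts hA _ _|
    exact: manifold_charts hB _ _].
split=> //.
- by apply: hausdorff_pair; [exact: manifold_hausdorff hA|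
    exact: manifold_hausdorff hB].
- by apply: second_countable_pair; [exact: manifold_countable hA|
    exact: manifold_countable hB].
- move=> [x y]; have [c Ac cx] := manifold_cover hA x.
  have [d Bd dy] := manifold_cover hB y.
  by exists (chart_prod c d) => //; exists c => //; exists d.
move=> c d hc hd k; have := charts c hc; have := charts d hd.
case: hc hd => [c1 Ac1 [c2 Bc2 <-]] [d1 Ad1 [d2 Bd2 <-]] cd cc.
have oW := chart_image_open cc (chart_dom_open cd).
apply: Ck_pair => //.
- apply: Ck_comp_linear (manifold_compat hA Ac1 Ad1 k) => //.
    exact: continuous_fst.
  by move=> _ [[x y] [[/= ? ?] [/= ? ?]] <-]; exists x.
- apply: Ck_comp_linear (manifold_compat hB Bc2 Bd2 k) => //.
    exact: continuous_snd.
  by move=> _ [[x y] [[/= ? ?] [/= ? ?]] <-]; exists y.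
Qed.

End Charts.

(** * Smooth maps and rearrangements of factors *)

Section SmoothTheory.
Context {R : realType}.

(** The intertwining relations [lic_map] and [lic_inv] are required on the whole
    space, beyond the chart domains, because a rearrangement of the factors of
    product charts satisfies them as equalities of total functions.  Hence
    chart expressions of composites can be rewritten without side conditions. *)
Record linear_in_charts (E F : normedModType R) (M N : topologicalType)
    (c : chart M E) (d : chart N F) (P : M -> N) (L : E -> F) : Prop := {
  lic_linear : linear L;
  lic_continuous : continuous L;
  lic_dom : forall x, chart_dom c x -> chart_dom d (P x);
  lic_map : forall x, chart_map d (P x) = L (chart_map c x);
  lic_inv : forall u, P (chart_inv c u) = chart_inv d (L u) }.

(** One chart of B per chart of A suffices: the other charts of B are reached
    through the transition maps. *)
Definition chartwise_linear (E F : normedModType R) (M N : topologicalType)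
    (A : set (chart M E)) (B : set (chart N F)) (P : M -> N) : Prop :=
  continuous P /\
  forall c, A c -> exists d L, B d /\ linear_in_charts c d P L.

Section Combinators.
Context {E F F' : normedModType R} {M N N' : topologicalType}.
Variables (A : set (chart M E)) (B : set (chart N F)) (B' : set (chart N' F')).

Lemma chartwise_linear_id : chartwise_linear A A id.
Proof.
split; first by move=> x; exact: cvg_id.
by move=> c Ac; exists c, id; split=> //; split=> // x; exact: cvg_id.
Qed.

Lemma chartwise_linear_fst (P : M -> N * N') :
  chartwise_linear A (atlas_prod B B') P ->
  chartwise_linear A B (fun x => (P x).1).
Proof.
move=> [cP hP]; split=> [x|c Ac].
  by apply: continuous_comp; [exact: cP|exact: cvg_fst].
have [_ [L [[d Bd [d' Bd' <-]] [lL cL hd hm hi]]]] := hP c Ac.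
exists d, (fun u => (L u).1); split=> //; split.
- by move=> a u v; rewrite lL.
- by move=> u; apply: continuous_comp; [exact: cL|exact: cvg_fst].
- by move=> x /hd[].
- by move=> x; rewrite -hm.
- by move=> u; rewrite hi.
Qed.

Lemma chartwise_linear_snd (P : M -> N * N') :
  chartwise_linear A (atlas_prod B B') P ->
  chartwise_linear A B' (fun x => (P x).2).
Proof.
move=> [cP hP]; split=> [x|c Ac].
  by apply: continuous_comp; [exact: cP|exact: cvg_snd].
have [_ [L [[d Bd [d' Bd' <-]] [lL cL hd hm hi]]]] := hP c Ac.
exists d', (fun u => (L u).2); split=> //; split.
- by move=> a u v; rewrite lL.
- by move=> u; apply: continuous_comp; [exact: cL|exact: cvg_snd].
- by move=> x /hd[].
- by move=> x; rewrite -hm.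
- by move=> u; rewrite hi.
Qed.

Lemma chartwise_linear_pair (P : M -> N) (P' : M -> N') :
  chartwise_linear A B P -> chartwise_linear A B' P' ->
  chartwise_linear A (atlas_prod B B') (fun x => (P x, P' x)).
Proof.
move=> [cP hP] [cP' hP']; split=> [x|c Ac].
  by apply: cvg_pair; [exact: cP|exact: cP'].
have [d [L [Bd [lL cL hd hm hi]]]] := hP c Ac.
have [d' [L' [Bd' [lL' cL' hd' hm' hi']]]] := hP' c Ac.
exists (chart_prod d d'), (fun u => (L u, L' u)); split.
  by exists d => //; exists d'.
split.
- by move=> a u v; rewrite lL lL'.
- by move=> u; apply: cvg_pair; [exact: cL|exact: cL'].
- by move=> x cx; split; [exact: hd|exact: hd'].
- by move=> x /=; rewrite hm hm'.
- by move=> u /=; rewrite hi hi'.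
Qed.

End Combinators.

Section SmoothMapTheory.
Context {E F : normedModType R} {M N : topologicalType}.
Variables (A : set (chart M E)) (B : set (chart N F)).
Hypotheses (hA : smooth_manifold A) (hB : smooth_manifold B).

(** The sets on which smoothness is tested in charts are open, so that the
    closure properties of [Ck] apply to them. *)
Lemma smooth_domain_open (f : M -> N) c d : continuous f -> A c -> B d ->
  open (chart_map c @` (chart_dom c `&` setT `&` f @^-1` chart_dom d)).
Proof.
move=> cf Ac Bd; rewrite setIT.
apply: chart_image_open; first exact: manifold_charts hA _ _.
apply: open_comp; first by move=> x _; exact: cf.
exact: chart_dom_open (manifold_charts hB Bd).
Qed.

Lemma smooth_continuous (f : M -> N) : smooth A B f -> continuous f.
Proof. by move=> [cf _] x; apply: cf; rewrite inE. Qed.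

(** In charts, the identity is the family of transition maps. *)
Lemma smooth_id : smooth A A id.
Proof.
split=> [x _|c d Ac Ad]; first exact: cvg_id.
by rewrite setIT; exact: manifold_compat hA _ _ Ac Ad.
Qed.

Lemma smooth_cst (a : N) : smooth A B (fun=> a).
Proof.
split=> [x _|c d Ac Bd k]; first exact: cvg_cst.
exact: Ck_cst.
Qed.

End SmoothMapTheory.

(** If P is L in the charts c and c', then f \o P in the charts c and d is f in
    the charts c' and d, precomposed with L. *)
Lemma smooth_comp_chartwise_linear (E F F' : normedModType R)
    (M N N' : topologicalType) (A : set (chart M E)) (B : set (chart N F))
    (B' : set (chart N' F')) (f : N -> N') (P : M -> N) :
  smooth_manifold A -> smooth_manifold B' ->
  smooth B B' f -> chartwise_linear A B P -> smooth A B' (f \o P).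
Proof.
move=> hA hB' sf [cP hP]; have cf := smooth_continuous sf.
have cfP : continuous (f \o P).
  by move=> x; apply: continuous_comp; [exact: cP|exact: cf].
split=> [x _|c d Ac Bd k]; first exact: cfP.
have [c' [L [Bc' [lL cL hd hm hi]]]] := hP c Ac.
have -> : in_charts c d (f \o P) = in_charts c' d f \o L.
  by apply/funext => u; rewrite /in_charts/= hi.
have oW := smooth_domain_open hA hB' cfP Ac Bd.
apply: Ck_comp_linear (sf.2 c' d Bc' Bd k) => //.
move=> _ [x [[cx _] dx] <-]; exists (P x); last by rewrite hm.
by split=> //; split=> //; exact: hd.
Qed.

Lemma smooth_pair (E F F' : normedModType R)
    (M N N' : topologicalType) (A : set (chart M E)) (B : set (chart N F))
    (B' : set (chart N' F')) (f : M -> N) (g : M -> N') :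
  smooth_manifold A -> smooth_manifold B -> smooth_manifold B' ->
  smooth A B f -> smooth A B' g ->
  smooth A (atlas_prod B B') (fun x => (f x, g x)).
Proof.
move=> hA hB hB' sf sg.
have cfg : continuous (fun x => (f x, g x)).
  by move=> x; apply: cvg_pair;
    [exact: smooth_continuous sf x|exact: smooth_continuous sg x].
split=> [x _|c d Ac hd k]; first exact: cfg.
have oW := smooth_domain_open hA (smooth_manifold_prod hB hB') cfg Ac hd.
case: hd oW => [d1 Bd1 [d2 Bd2 <-]] oW.
apply: Ck_pair => //.
- apply: Ck_subset (sf.2 c d1 Ac Bd1 k).
  by move=> _ [x [cx [/= ? ?]] <-]; exists x.
- apply: Ck_subset (sg.2 c d2 Ac Bd2 k).
  by move=> _ [x [cx [/= ? ?]] <-]; exists x.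
Qed.

Lemma chartwise_linear_smooth (E F : normedModType R)
    (M N : topologicalType) (A : set (chart M E)) (B : set (chart N F))
    (P : M -> N) :
  smooth_manifold A -> smooth_manifold B ->
  chartwise_linear A B P -> smooth A B P.
Proof.
by move=> hA hB; exact: smooth_comp_chartwise_linear (smooth_id hB).
Qed.

(** With T the transition map and S the reverse one, T \o S is the identity near
    the image of x, so 'd S gives a right inverse of 'd T by the chain rule. *)
Lemma transition_diff_surj (E : normedModType R) (M : topologicalType)
    (A : set (chart M E)) c d x :
  smooth_manifold A -> A c -> A d -> chart_dom c x -> chart_dom d x ->
  differentiable (chart_map d \o chart_inv c) (chart_map c x) /\
  range ('d (chart_map d \o chart_inv c) (chart_map c x) : E -> E) = setT.
Proof.
move=> hA Ac Ad cx dx.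
have hc := manifold_charts hA Ac; have hd := manifold_charts hA Ad.
have dT c1 c2 : A c1 -> A c2 -> chart_dom c1 x -> chart_dom c2 x ->
    differentiable (chart_map c2 \o chart_inv c1) (chart_map c1 x).
  move=> A1 A2 x1 x2; have [+ _] := manifold_compat hA A1 A2 1%N.
  by apply; rewrite inE; exists x.
have dcd := dT c d Ac Ad cx dx; have ddc := dT d c Ad Ac dx cx.
split=> //; apply/seteqP; split=> // w _.
set T := chart_map d \o chart_inv c in dcd *.
set S := chart_map c \o chart_inv d in ddc *.
have Sx : S (chart_map d x) = chart_map c x.
  by rewrite /S/= (chart_mapK hd)// inE.
have TS : \forall u \near chart_map d x, (T \o S) u = id u.
  have : nbhs (chart_map d x) (chart_map d @` (chart_dom d `&` chart_dom c)).
    apply: open_nbhs_nbhs; split; last by exists x.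
    exact: chart_image_open (chart_dom_open hc).
  apply: filterS => _ [y [dy cy] <-]; rewrite /T/S/=.
  by rewrite (chart_mapK hd) ?(chart_mapK hc)// inE.
have dTx : differentiable T (S (chart_map d x)) by rewrite Sx.
have [_ e] := near_eq_diff TS (differentiable_comp ddc dTx).
exists ('d S (chart_map d x) w) => //.
have := congr1 (@^~ w) e; rewrite diff_comp//= Sx => <-.
by rewrite diff_val.
Qed.

(** In any pair of charts, P is a linear surjection followed by a transition
    map, whose derivative is onto. *)
Lemma submersion_chartwise_linear (E F : normedModType R)
    (M N : topologicalType) (A : set (chart M E)) (B : set (chart N F))
    (P : M -> N) :
  smooth_manifold A -> smooth_manifold B -> continuous P ->
  (forall c, A c -> exists d L,
    [/\ B d, linear_in_charts c d P L & range L = setT]) ->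
  submersion A B P.
Proof.
move=> hA hB cP hP; split.
  apply: chartwise_linear_smooth => //; split=> // c Ac.
  by have [d [L [? ? _]]] := hP c Ac; exists d, L.
move=> c d x Ac Bd cx dPx.
have [c' [L [Bc' [lL cL hd hm hi] sL]]] := hP c Ac.
have [dT sT] := transition_diff_surj hB Bc' Bd (hd x cx) dPx.
have -> : in_charts c d P = (chart_map d \o chart_inv c') \o L.
  by apply/funext => u; rewrite /in_charts/= hi.
have [dL dLE] := linear_continuous_diff (chart_map c x) lL cL.
rewrite diff_comp// -?hm// dLE; apply/seteqP; split=> // w _.
have : setT w by []; rewrite -sT => -[v _ <-].
have : setT v by []; rewrite -sL => -[u _ <-].
by exists u.
Qed.

End SmoothTheory.

(** * The trivial Lie groupoid *)

Lemma smooth_subset_global (R : realType) (E F : normedModType R)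
    (M N : topologicalType) (A : set (chart M E)) (B : set (chart N F))
    (S : set M) (g : M -> N) (f : S -> N) :
  smooth A B g -> (forall y : S, f y = g (val y)) -> smooth_subset A B f.
Proof. by move=> sg fg x; exists setT, g; split=> //; exact: openT. Qed.

Section TrivialGroupoidTheory.
Context {R : realType} {E F : normedModType R}.
Context {G : topGroupType} {M : topologicalType}.
Variables (AG : set (chart G E)) (AM : set (chart M F)).
Hypotheses (hG : lie_group AG) (hM : smooth_manifold AM).

Let AX := atlas_prod (atlas_prod AM AG) AM.

Let hX : smooth_manifold AX.
Proof.
apply: smooth_manifold_prod => //; apply: smooth_manifold_prod => //.
exact: lie_manifold hG.
Qed.

Lemma trivial_groupoid_transitive : transitive_groupoid (trivial_groupoid M G).
Proof.
move=> m; apply/seteqP; split=> // n _.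
by exists (m, 1%g, n).
Qed.

Lemma smooth_triple (E' : normedModType R) (N : topologicalType)
    (A : set (chart N E')) (f : N -> M) (g : N -> G) (h : N -> M) :
  smooth_manifold A -> smooth A AM f -> smooth A AG g -> smooth A AM h ->
  smooth A AX (fun x => (f x, g x, h x)).
Proof.
have hGm := lie_manifold hG.
move=> hA sf sg sh; apply: smooth_pair => //.
  exact: smooth_manifold_prod.
exact: smooth_pair.
Qed.

Lemma lie_trivial_groupoid : lie_groupoid AM AX (trivial_groupoid M G).
Proof.
have hGm := lie_manifold hG; have hXX := smooth_manifold_prod hX hX.
have Xid := chartwise_linear_id AX.
have Xm := chartwise_linear_fst (chartwise_linear_fst Xid).
have Xg := chartwise_linear_snd (chartwise_linear_fst Xid).
have Xn := chartwise_linear_snd Xid.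
split=> //.
- apply: submersion_chartwise_linear => //; first exact: continuous_snd.
  move=> _ [c1 h1 [c2 h2 <-]]; exists c2, snd; split=> //.
    by split=> //; [exact: continuous_snd|move=> x []].
  by apply/seteqP; split=> // w _; exists (0, w).
- apply: submersion_chartwise_linear => //.
    by move=> x; apply: (cvg_comp fst fst); exact: cvg_fst.
  move=> _ [_ [c1 h1 [c2 h2 <-]] [c3 h3 <-]].
  exists c1, (fun u => u.1.1); split=> //.
    split=> //; last by move=> x [[]].
    by move=> x; apply: (cvg_comp fst fst); exact: cvg_fst.
  by apply/seteqP; split=> // w _; exists (w, 0, 0).
- apply: smooth_triple => //; try exact: smooth_id.
  exact: smooth_cst.
- apply: smooth_triple => //; try exact: chartwise_linear_smooth.
  exact: smooth_comp_chartwise_linear (lie_inv hG) Xg.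
have XXid := chartwise_linear_id (atlas_prod AX AX).
have X1 := chartwise_linear_fst XXid.
have X2 := chartwise_linear_snd XXid.
apply: (@smooth_subset_global _ _ _ _ _ _ _ _
  (fun p => (p.1.1.1, (p.1.1.2 * p.2.1.2)%g, p.2.2))) => //.
apply: smooth_triple => //.
- apply: chartwise_linear_smooth => //.
  exact: chartwise_linear_fst (chartwise_linear_fst X1).
- apply: (smooth_comp_chartwise_linear (P := fun p => (p.1.1.2, p.2.1.2)) _ _
    (lie_mul hG)) => //.
  exact: chartwise_linear_pair (chartwise_linear_snd (chartwise_linear_fst X1))
    (chartwise_linear_snd (chartwise_linear_fst X2)).
- apply: chartwise_linear_smooth => //; exact: chartwise_linear_snd X2.
Qed.

End TrivialGroupoidTheory.

Theorem proposition4p28 (R : realType) (p q : nat)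
    (G : topGroupType) (M : topologicalType)
    (AG : set (chart G 'rV[R]_p)) (AM : set (chart M 'rV[R]_q))
    (B0 : G -> G) (B1 : G * M -> M)
    (hG : rota_baxter_lie_group AG B0)
    (hM : smooth_manifold AM)
    (hB1 : rota_baxter_action AG AM B0 B1) :
  let AMGM := atlas_prod (atlas_prod AM AG) AM in
  [/\ lie_groupoid AM AMGM (trivial_groupoid M G),
      transitive_groupoid (trivial_groupoid M G)
    & rota_baxter_operator AMGM (H := trivial_groupoid M G)
        (fun h => bundle_map B0 B1 (isotropy_coord h))].
Proof.
move=> AMGM; have hL := rblg_lie hG.
have hX : smooth_manifold AMGM.
  apply: smooth_manifold_prod => //; apply: smooth_manifold_prod => //.
  exact: lie_manifold hL.
split; [exact: lie_trivial_groupoid|exact: trivial_groupoid_transitive|].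
have Xid := chartwise_linear_id AMGM.
have Xm := chartwise_linear_fst (chartwise_linear_fst Xid).
have Xg := chartwise_linear_snd (chartwise_linear_fst Xid).
unshelve econstructor.
- by [].
- apply: (@smooth_subset_global _ _ _ _ _ _ _ _
    (fun x => (x.1.1, B0 x.1.2, B1 (x.1.2, x.1.1)))) => //.
  apply: smooth_triple => //.
  + exact: chartwise_linear_smooth.
  + have hGm := lie_manifold hL.
    exact: smooth_comp_chartwise_linear hX hGm (rblg_smooth hG) Xg.
  + exact: (smooth_comp_chartwise_linear (P := fun x => (x.1.2, x.1.1)) hX hM
      (rba_smooth hB1) (chartwise_linear_pair Xg Xm)).
move=> g h e.
(* Unfolded, composability of B g and B h allows replacing the base point of h
   by B1 of g, which is the shape of the action law. *)
have e' : B1 ((val g).1.2, (val g).1.1) = (val h).1.1 := e.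
by rewrite /bundle_map /isotropy_coord /= (rblg_mul hG) -e' (rba_mul hB1).
Qed.
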